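(* Let $0\le\ell<u$, $n\ge1$, and $\boldsymbol\xi=(\xi_0,\ldots,\xi_n)$ with $\ell=\xi_0<\xi_1<\cdots<\xi_n=u$. Then $$\operatorname{vol}(\breve{U}^*_2(\boldsymbol\xi))\le\operatorname{vol}(\breve{S}^0_2),$$ and equality holds only if $n=1$ and $\ell=0$.
   Context: Let $f(x):=x^2$ and $s:=\frac{f(u)-f(\ell)}{u-\ell}$. The na\''{\i}ve relaxation is $$\breve{S}^0_2:=\left\{(x,y,z)\in\mathbb{R}^3:\ (f(\ell)-s\ell)z+sx\ge y\ge f(x),\ uz\ge x\ge\ell z,\ 1\ge z\ge 0\right\}.$$ Given $\boldsymbol\xi$, put $\tau_0:=\ell$, $\tau_{n+1}:=u$ and, for $i=1,\ldots,n$, $$\tau_i:=\frac{[f(\xi_i)-f'(\xi_i)\xi_i]-[f(\xi_{i-1})-f'(\xi_{i-1})\xi_{i-1}]}{f'(\xi_{i-1})-f'(\xi_i)}.$$ Let $g:[\ell,u]\to\mathbb{R}$ be the piecewise-linear function whose graph connects, in order, $(\ell,f(\ell))$, the points $(\tau_i,\ f(\xi_i)+f'(\xi_i)(\tau_i-\xi_i))$ for $i=1,\ldots,n$, and $(u,f(u))$. The set $\breve{U}^*_2(\boldsymbol\xi)$ is the closure of the convex hull of $$\left\{(x,y,z)\in\mathbb{R}^3:\ (f(\ell)-s\ell)z+sx\ge y\ge z\,g(x/z),\ uz\ge x\ge \ell z,\ 1\ge z>0,\ y\ge 0\right\}.$$ $\operatorname{vol}$ denotes 3-dimensional volume. *)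

(* Defs.v *)
From HB Require Import structures.
From mathcomp Require Import all_boot all_order all_algebra.
From mathcomp Require Import all_classical all_reals all_analysis.

Set Implicit Arguments.
Unset Strict Implicit.
Unset Printing Implicit Defensive.

Import Order.TTheory GRing.Theory Num.Theory.
Import numFieldNormedType.Exports.

Local Open Scope classical_set_scope.
Local Open Scope ring_scope.

(* Points of 3-space are written (x, y, z), i.e. ((x, y), z). *)

Definition vol3 (R : realType) : set (R * R * R) -> \bar R :=
  ((@lebesgue_measure R \x @lebesgue_measure R) \x @lebesgue_measure R)%E.

Definition convex_hull3 (R : realType) (A : set (R * R * R)) : set (R * R * R) :=
  smallest (@convex_set R (R^o * R^o * R^o)%type) A.

(* The piecewise-linear function whose graph joins [p] to the successive points
   of [s], assumed sorted by first coordinate; values outside the abscissae of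
   these points are junk. *)
Fixpoint piecewise_linear (R : realType) (p : R * R) (s : seq (R * R)) (x : R)
    : R :=
  if s is q :: s' then
    if x <= q.1 then line_path p.2 q.2 (factor p.1 q.1 x)
    else piecewise_linear q s' x
  else p.2.

Section Relaxations.
Variable R : realType.

Definition sq (x : R) : R := x ^+ 2.

Definition secant_slope (l u : R) : R := (sq u - sq l) / (u - l).

Definition naive_relaxation (l u : R) : set (R * R * R) :=
  let s := secant_slope l u in
  [set p | let: (x, y, z) := p in
    [/\ sq x <= y <= (sq l - s * l) * z + s * x,
        l * z <= x <= u * z
      & 0 <= z <= 1]].

(* Abscissa of the intersection of the tangents at [xi`_i.-1] and [xi`_i];
   meaningful for [0 < i < size xi]. *)
Definition tau (xi : seq R) (i : nat) : R :=
  ((sq xi`_i - derive1 sq xi`_i * xi`_i)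
     - (sq xi`_i.-1 - derive1 sq xi`_i.-1 * xi`_i.-1))
  / (derive1 sq xi`_i.-1 - derive1 sq xi`_i).

Definition tangent_point (xi : seq R) (i : nat) : R * R :=
  (tau xi i, sq xi`_i + derive1 sq xi`_i * (tau xi i - xi`_i)).

Definition tangent_under_estimator (l u : R) (xi : seq R) : R -> R :=
  piecewise_linear (l, sq l)
    (rcons [seq tangent_point xi i | i <- iota 1 (size xi).-1] (u, sq u)).

Definition perspective_relaxation (l u : R) (xi : seq R) : set (R * R * R) :=
  let s := secant_slope l u in
  let g := tangent_under_estimator l u xi in
  closure (convex_hull3 [set p | let: (x, y, z) := p in
    [/\ z * g (x / z) <= y <= (sq l - s * l) * z + s * x,
        l * z <= x <= u * z,
        0 < z <= 1
      & 0 <= y]]).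

End Relaxations.

(* Main.v *)
Require Import Defs.
From HB Require Import structures.
From mathcomp Require Import all_boot all_order all_algebra.
From mathcomp Require Import all_classical all_reals all_analysis.
From mathcomp Require Import measurable_realfun ring lra.
Import Order.TTheory GRing.Theory Num.Theory.
Import numFieldNormedType.Exports.
Local Open Scope classical_set_scope.
Local Open Scope ring_scope.

(** Write [d = u - l] and [c = xi_1], so that [l < c <= u].

    The naive relaxation has section of height [(l + u) x - l u z - x^2] above
    each [(x, z)] with [0 <= z <= 1] and [l z <= x <= u z]; integrating in [x],
    then in [z], gives the volume [d / 12 * (d^2 + l u)]
    ([vol3_naive_relaxation]).

    The perspective relaxation is a cone with apex at the origin whose base, at
    [z = 1], lies between the secant of [x^2] and the tangents at the [xi_i].
    An upper bound on its volume is enough: it lies below the secant and above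
    the three tangents at [l], [c] and [u], since [g] dominates every tangent at
    some [xi_j] ([tangent_under_estimator_ge]), and homogeneous linear
    inequalities survive taking the closed convex hull ([hull_halfspace]).
    Above each pair [(x, z)] the largest of these three tangents is the one at
    [l], [c] or [u] according to the position of [x] with respect to
    [(l + c) / 2 z] and [(c + u) / 2 z]. This cuts the solid that they bound
    into three wedges ([perspective_cover]) with total volume
      [d^3 / 18 + ((c - l)^3 + (u - c)^3) / 36
         = d / 12 * (d^2 - (c - l) (u - c))].

    The naive volume exceeds this bound by [d / 12 * (l u + (c - l) (u - c))].
    Both products are nonnegative, and they vanish together only if [l = 0] and
    [c = u]; as the [xi_i] increase strictly to [xi_n = u], the latter forces
    [n = 1].

    The naive relaxation and the three wedges are measured by one formula
    ([vol3_wedge]), for solids bounded below by a quadratic and above by a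
    linear function of [(x, z)]. *)

(** * Volume in 3-space *)
Section PlaneMeasure.
Variable R : realType.

(** A constant for the product measure, to which its sigma-finiteness can be
    attached: exchanging the order of integration in [vol3] requires it. *)
Definition area2 : set (measurableTypeR R * measurableTypeR R) -> \bar R :=
  (@lebesgue_measure R \x @lebesgue_measure R)%E.

HB.instance Definition _ := Measure.on area2.

Let area2_sigma_finite : sigma_finite setT area2.
Proof.
have /sigma_finiteP[F [TF ndF Foo]] := sigma_finiteT (@lebesgue_measure R).
exists (fun n => F n `*` F n) => [|n]; last first.
  have [mF Ffin] := Foo n; split; first exact: measurableX.
  by rewrite /area2 product_measure1E// lte_mul_pinfty// ge0_fin_numE.
apply/seteqP; split=> // -[x y] _.
have [[i _ Fx] [j _ Fy]] : (\bigcup_k F k) x /\ (\bigcup_k F k) y.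
  by rewrite -TF.
exists (maxn i j) => //; split=> /=.
- by move: x Fx; exact/subsetPset/ndF/leq_maxl.
- by move: y Fy; exact/subsetPset/ndF/leq_maxr.
Qed.

HB.instance Definition _ :=
  Measure_isSigmaFinite.Build _ _ _ area2 area2_sigma_finite.

End PlaneMeasure.

(** Slicing by [z] first, then by [x]: sections of the solids below are simple
    intervals in [y], whereas the definition of [vol3] integrates over [z]
    innermost. Both orders define measures agreeing on boxes. *)
Lemma vol3_sectionE {R : realType} (A : set (R * R * R)) : measurable A ->
  vol3 A = (\int[lebesgue_measure]_z \int[lebesgue_measure]_x
    (@lebesgue_measure R) [set y | A (x, y, z)])%E.
Proof.
move=> mA.
pose vol : {measure set (measurableTypeR R * measurableTypeR R
    * measurableTypeR R)%type -> \bar R} :=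
  (@area2 R \x^ @lebesgue_measure R)%E.
have volX B I : measurable B -> measurable I ->
  vol (B `*` I) = (area2 R B * lebesgue_measure I)%E.
  exact: product_measure2E.
have -> : vol3 A = vol A := product_measure_unique volX mA.
apply: eq_integral => z _ /=; rewrite /area2 {1}/product_measure1.
apply: eq_integral => x _ /=; congr (lebesgue_measure _).
by apply/seteqP; split => y /=; rewrite /xsection/= !inE/= /ysection/= inE.
Qed.

Lemma integral_deriv_poly {R : realType} (p : {poly R}) (a b : R) : a <= b ->
  (\int[lebesgue_measure]_(x in `[a, b]) (p^`().[x])%:E
   = (p.[b] - p.[a])%:E)%E.
Proof.
rewrite le_eqVlt => /predU1P[<-|ab].
  by rewrite set_itv1 integral_set1 subrr.
rewrite (@continuous_FTC2 _ _ (horner p)) ?EFinB //.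
- by apply: continuous_subspaceT => x; exact: continuous_horner.
- split=> [x _| |]; first exact: derivable_horner.
  + by apply: cvg_at_right_filter; exact: continuous_horner.
  + by apply: cvg_at_left_filter; exact: continuous_horner.
- by move=> x _; rewrite -derivE.
Qed.

Lemma vol3_le {R : realType} (A B : set (R * R * R)) :
  measurable A -> measurable B -> A `<=` B -> (vol3 A <= vol3 B)%E.
Proof. by move=> mA mB AB; apply: le_measure; rewrite ?inE. Qed.

Lemma vol3_setU {R : realType} (A B : set (R * R * R)) :
  measurable A -> measurable B -> (vol3 (A `|` B) <= vol3 A + vol3 B)%E.
Proof. by move=> mA mB; rewrite /vol3 measureU2. Qed.

(** The measurable sets of [vol3] are those of the product sigma-algebra, so
    that closed sets have to be related to boxes: an open set is the union of
    the countably many rational cubes it contains. *)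
Lemma closed_measurable3 {R : realType} (K : set (R * R * R)) :
  closed K -> measurable K.
Proof.
move=> /closed_openC oK; rewrite -[K]setCK; apply: measurableC.
move: (~` K) oK => {K} U oU.
pose box (c : rat * rat * rat) (r : rat) : set (R * R * R) :=
  ball (ratr c.1.1 : R) (ratr r) `*` ball (ratr c.1.2 : R) (ratr r)
    `*` ball (ratr c.2 : R) (ratr r).
have -> : U = \bigcup_(i in [set i | box i.1 i.2 `<=` U]) box i.1 i.2.
  apply/seteqP; split=> [[[x y] z] Uxyz|p [i iU ip]]; last exact: iU.
  have /nbhs_ballP[e /= e0 eU] : nbhs (x, y, z) U by exact: open_nbhs_nbhs.
  have e20 : 0 < e / 2 by rewrite divr_gt0.
  have [r] := rat_in_itvoo e20; rewrite in_itv/= => /andP[r0 re].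
  (* the cube has radius r < e / 2, so that it fits in the ball of radius e
     around any of its points *)
  have near_rat (t : R) : exists q : rat, `|ratr q - t| < ratr r.
    have tr : t - ratr r < t + ratr r by lra.
    have [q] := rat_in_itvoo tr; rewrite in_itv/= => qt.
    by exists q; rewrite ltr_distl.
  have [a ax] := near_rat x; have [b b_y] := near_rat y.
  have [c cz] := near_rat z.
  exists ((a, b, c), r); last by split => //; split.
  move=> [[x' y'] z'] [[/= ax' by'] cz']; apply: eU.
  have tri (s t q : R) : `|q - s| < ratr r -> `|q - t| < ratr r ->
      `|s - t| < e.
    move=> qs qt; rewrite (_ : s - t = (q - t) - (q - s)); last by ring.
    by rewrite (le_lt_trans (ler_normB _ _))//; lra.
  by split => /=; [split => /=|]; apply: tri; eassumption.
rewrite bigcup_mkcond; apply: countable_bigcupT_measurable => [|i].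
  exact: countableP.
case: ifPn => // _; apply: measurableX; first apply: measurableX.
all: exact: measurable_ball.
Qed.

(** * Half-spaces and the closed convex hull *)

Lemma closed_quadratic_ge0 {R : realType} (e a b c d : R) :
  closed [set p : R * R * R |
    0 <= e * p.1.1 ^+ 2 + (a * p.1.1 + b * p.1.2 + c * p.2 + d)].
Proof.
have [cx cy cz] : [/\ continuous (fun p : R * R * R => p.1.1),
    continuous (fun p : R * R * R => p.1.2)
  & continuous (fun p : R * R * R => p.2)].
  split=> -[[x y] z]; last exact: cvg_snd.
  - by apply: (cvg_comp (@fst (R * R) R) fst); exact: cvg_fst.
  - by apply: (cvg_comp (@fst (R * R) R) snd); [exact: cvg_fst|exact: cvg_snd].
pose f (p : R * R * R) : R :=
  e * p.1.1 ^+ 2 + (a * p.1.1 + b * p.1.2 + c * p.2 + d).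
apply: (@preimage_closed _ _ f [set t | 0 <= t]) => [p _|]; last first.
  exact: closed_ge.
apply: cvgD; first by apply: cvgM; [exact: cvg_cst|apply: cvgM; exact: cx].
apply: cvgD; last exact: cvg_cst.
apply: cvgD; first apply: cvgD.
- by apply: cvgM; [exact: cvg_cst|exact: cx].
- by apply: cvgM; [exact: cvg_cst|exact: cy].
- by apply: cvgM; [exact: cvg_cst|exact: cz].
Qed.

(** A closed half-space is convex and closed, so it contains the closed convex
    hull of each of its subsets: affine inequalities may be checked on the
    generating set. *)
Lemma hull_halfspace {R : realType} (a b c d : R) (A : set (R * R * R)) :
  (forall x y z, A (x, y, z) -> 0 <= a * x + b * y + c * z + d) ->
  forall x y z, closure (convex_hull3 A) (x, y, z) ->
    0 <= a * x + b * y + c * z + d.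
Proof.
move=> AH x y z.
pose f (p : R * R * R) : R := a * p.1.1 + b * p.1.2 + c * p.2 + d.
have closed_f : closed [set p | 0 <= f p].
  have := closed_quadratic_ge0 0 a b c d.
  by under eq_set do rewrite mul0r add0r.
have hull_f : convex_hull3 A `<=` [set p | 0 <= f p].
  apply: smallest_sub => [p q t|[[x' y'] z'] /AH //].
  rewrite !inE; case: p => [[px py] pz]; case: q => [[qx qy] qz].
  rewrite /f /= => fp fq.
  pose w : R := t%:num.
  have w01 : 0 <= w <= 1 by rewrite /w; apply/andP; split.
  change (0 <= a * (w * px + (1 - w) * qx) + b * (w * py + (1 - w) * qy)
               + c * (w * pz + (1 - w) * qz) + d).
  move: w01 => /andP[w0 w1].
  rewrite [leRHS](_ : _ = w * (a * px + b * py + c * pz + d)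
    + (1 - w) * (a * qx + b * qy + c * qz + d)); last by ring.
  by rewrite addr_ge0// mulr_ge0// subr_ge0.
by move=> /(closureS hull_f); rewrite -(closure_id _).1.
Qed.

(** * Volume of a wedge *)

(** The lower boundary is quadratic in order to cover [x^2] ([p = 1]) as well
    as the tangents ([p = 0]). *)
Definition wedge {R : realType} (a b p k1 m1 k2 m2 : R) : set (R * R * R) :=
  [set q | let: (x, y, z) := q in
    [/\ p * x ^+ 2 + k1 * x + m1 * z <= y <= k2 * x + m2 * z,
        a * z <= x <= b * z
      & 0 <= z <= 1]].

Lemma measurable_wedge {R : realType} (a b p k1 m1 k2 m2 : R) :
  measurable (wedge a b p k1 m1 k2 m2).
Proof.
pose H (e a b c d : R) : set (R * R * R) := [set p : R * R * R |
    0 <= e * p.1.1 ^+ 2 + (a * p.1.1 + b * p.1.2 + c * p.2 + d)].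
have mH e a' b' c d : measurable (H e a' b' c d).
  by apply: closed_measurable3; exact: closed_quadratic_ge0.
have -> : wedge a b p k1 m1 k2 m2 =
    H (- p) (- k1) 1 (- m1) 0 `&` H 0 k2 (- 1) m2 0 `&`
    (H 0 1 0 (- a) 0 `&` H 0 (- 1) 0 b 0) `&`
    (H 0 0 0 1 0 `&` H 0 0 0 (- 1) 1).
  apply/seteqP; split=> -[[x y] z]; rewrite /wedge /H /=.
    move=> [/andP[? ?] /andP[? ?] /andP[? ?]].
    by do !split; rewrite /=; lra.
  move=> [[[h1 h2] [h3 h4]] [h5 h6]].
  by split; apply/andP; split; lra.
by repeat apply: measurableI; exact: mH.
Qed.

(** At height [z] the base of the section scales with [z], so its area is a
    combination of [z^2] (linear terms) and [z^3] (quadratic term); [c z] and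
    [v] below are primitives, in [x] and in [z], of the section functions. *)
Lemma vol3_wedge {R : realType} (a b p k1 m1 k2 m2 : R) : a <= b ->
  (forall x z, 0 <= z <= 1 -> a * z <= x <= b * z ->
    p * x ^+ 2 + k1 * x + m1 * z <= k2 * x + m2 * z) ->
  vol3 (wedge a b p k1 m1 k2 m2) =
    ((k2 - k1) * (b ^+ 2 - a ^+ 2) / 6 + (m2 - m1) * (b - a) / 3
      - p * (b ^+ 3 - a ^+ 3) / 12)%:E.
Proof.
move=> ab le12.
pose c (z : R) : {poly R} := (- p / 3) *: 'X^3 + ((k2 - k1) / 2) *: 'X^2
  + ((m2 - m1) * z) *: 'X.
pose v : {poly R} := (- p * (b ^+ 3 - a ^+ 3) / 12) *: 'X^4
  + ((k2 - k1) * (b ^+ 2 - a ^+ 2) / 6 + (m2 - m1) * (b - a) / 3) *: 'X^3.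
rewrite vol3_sectionE; last exact: measurable_wedge.
transitivity (\int[lebesgue_measure]_(z in `[0%R, 1%R]) (v^`().[z])%:E)%E;
  last first.
  rewrite integral_deriv_poly//; congr EFin.
  by rewrite /v !hornerE /=; field.
rewrite [RHS]integral_mkcond; apply: eq_integral => z _.
rewrite patchE; case: ifPn => [|/negP z01]; last first.
  rewrite integral0_eq// => x _.
  rewrite [X in lebesgue_measure X](_ : _ = set0) ?measure0//.
  rewrite -subset0 => y [_ _ zz]; apply: z01.
  by rewrite inE/= in_itv.
rewrite inE/= in_itv/= => z01.
have abz : a * z <= b * z by case/andP: z01 => z0 _; rewrite ler_wpM2r.
transitivity (\int[lebesgue_measure]_(x in `[(a * z)%R, (b * z)%R])
    ((c z)^`().[x])%:E)%E; last first.
  rewrite integral_deriv_poly//; congr EFin.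
  by rewrite /c /v !poly.derivE !hornerE /=; field.
rewrite [RHS]integral_mkcond; apply: eq_integral => x _.
rewrite patchE; case: ifPn => [|/negP xz]; last first.
  rewrite [X in lebesgue_measure X](_ : _ = set0) ?measure0//.
  rewrite -subset0 => y [_ xx _]; apply: xz.
  by rewrite inE/= in_itv.
rewrite inE/= in_itv/= => xz.
rewrite [X in lebesgue_measure X](_ : _ =
  `[p * x ^+ 2 + k1 * x + m1 * z, k2 * x + m2 * z]%classic); last first.
  by apply/seteqP; split=> y /=; rewrite in_itv/=; [case|].
rewrite lebesgue_measure_itv/= lte_fin.
have := le12 x z z01 xz; rewrite le_eqVlt => /predU1P[h|h].
  rewrite h ltxx; congr EFin.
  by rewrite /c !poly.derivE !hornerE /=; lra.
rewrite h -EFinB; congr EFin.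
by rewrite /c !poly.derivE !hornerE /=; lra.
Qed.

(** * The tangent under-estimator *)

Lemma derive1_sq {R : realType} (x : R) : derive1 (@sq R) x = 2 * x.
Proof.
have -> : @sq R = horner ('X^2 : {poly R}).
  by apply/funext => t; rewrite /sq hornerXn.
by rewrite -derivE derivXn hornerMn hornerXn expr1 mulr_natl.
Qed.

Lemma tangent_pointE {R : realType} (xi : seq R) (i : nat) :
  xi`_i.-1 != xi`_i ->
  tangent_point xi i = ((xi`_i.-1 + xi`_i) / 2, xi`_i.-1 * xi`_i).
Proof.
move=> neq; have d0 : xi`_i.-1 - xi`_i != 0 by rewrite subr_eq0.
have tauE : tau xi i = (xi`_i.-1 + xi`_i) / 2.
  rewrite /tau !derive1_sq /sq; field.
  by rewrite -mulrBr mulf_neq0 ?pnatr_eq0.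
by rewrite /tangent_point tauE derive1_sq /sq; congr pair; field.
Qed.

(** On each piece, the value is a convex combination of the ordinates of two
    vertices, so it is enough to compare at the vertices. *)
Lemma piecewise_linear_ge {R : realType} (a b : R) (p : R * R)
    (s : seq (R * R)) (x : R) :
  path (fun q r : R * R => q.1 < r.1) p s ->
  {in p :: s, forall q, a * q.1 + b <= q.2} ->
  p.1 <= x <= (last p s).1 -> a * x + b <= piecewise_linear p s x.
Proof.
elim: s p => [|q s ih] p /= => [_ above /andP[px xp]|].
  have -> : x = p.1 by apply/eqP; rewrite eq_le px xp.
  by rewrite above// mem_head.
move=> /andP[pq qs] above /andP[px xl].
case: ifPn => [xq|]; last first.
  rewrite -ltNge => qx; apply: ih; rewrite ?(ltW qx)//.
  by move=> r rs; apply: above; rewrite inE rs orbT.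
have := above p (mem_head _ _).
have := above q; rewrite !inE eqxx orbT => /(_ isT).
rewrite /line_path /factor.
have pq0 : 0 < q.1 - p.1 by rewrite subr_gt0.
set t := (x - p.1) / (q.1 - p.1).
have t0 : 0 <= t by rewrite divr_ge0 ?subr_ge0// ltW.
have t1 : 0 <= 1 - t by rewrite subr_ge0 ler_pdivrMr// mul1r lerD2r.
have -> : x = (1 - t) * p.1 + t * q.1.
  by rewrite /t; field; rewrite gt_eqF.
move=> hq hp.
rewrite [leLHS](_ : _ = (1 - t) * (a * p.1 + b) + t * (a * q.1 + b));
  last by ring.
by rewrite lerD// ler_wpM2l.
Qed.

Lemma sorted_tuple_nth_lt {R : realType} (n : nat) (xi : n.+1.-tuple R) :
  sorted <%R xi -> forall i k : nat, (i < k <= n)%N -> xi`_i < xi`_k.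
Proof.
move=> xi_incr i k /andP[ik kn]; apply: (sorted_ltn_nth lt_trans) => //;
  rewrite inE size_tuple// ltnS//; exact: leq_trans (ltnW ik) kn.
Qed.

(** The end points of the graph of [g] are on the parabola, hence above its
    tangents. The other vertices are
    [((xi_(i-1) + xi_i) / 2, xi_(i-1) xi_i)], and exceed the tangent at [xi_j]
    by [(xi_(i-1) - xi_j) (xi_i - xi_j)], where the factors have the same sign
    since no [xi_j] lies strictly between [xi_(i-1)] and [xi_i]. *)
Lemma tangent_under_estimator_ge {R : realType} (l u : R) (n j : nat)
    (xi : n.+1.-tuple R) (x : R) :
  (1 <= n)%N -> xi`_0 = l -> xi`_n = u -> sorted <%R xi -> (j <= n)%N ->
  l <= x <= u ->
  2 * xi`_j * x - xi`_j ^+ 2 <= tangent_under_estimator l u xi x.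
Proof.
move=> n1 xi0 xin xi_incr jn lxu.
have xi_lt := sorted_tuple_nth_lt _ _ xi_incr.
have xi_le (i k : nat) : (i <= k <= n)%N -> xi`_i <= xi`_k.
  move=> /andP[+ kn]; rewrite leq_eqVlt => /predU1P[->//|ik].
  by rewrite ltW// xi_lt// ik.
have tpE (i : nat) : (0 < i <= n)%N ->
    tangent_point xi i = ((xi`_i.-1 + xi`_i) / 2, xi`_i.-1 * xi`_i).
  move=> /andP[i0 iln]; apply: tangent_pointE;
    rewrite lt_eqF// xi_lt// iln andbT.
  by case: (i) i0.
have tau_itv (i : nat) : (0 < i <= n)%N ->
    xi`_i.-1 < (tangent_point xi i).1 < xi`_i.
  move=> i1n; have : xi`_i.-1 < xi`_i.
    by case/andP: i1n => i0 iln; rewrite xi_lt// iln andbT; case: (i) i0.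
  by rewrite tpE//= => ii; apply/andP; split; lra.
rewrite /tangent_under_estimator size_tuple /=.
set s := rcons _ _.
have nth_s (k : nat) : (k <= n)%N -> nth (l, sq l) s k =
    if (k < n)%N then tangent_point xi k.+1 else (u, sq u).
  move=> kn; rewrite nth_rcons size_map size_iota; case: ltnP => kn'.
    by rewrite (nth_map 0%N) ?size_iota// nth_iota// add1n.
  by rewrite eqn_leq kn kn'.
have size_s : size s = n.+1 by rewrite size_rcons size_map size_iota.
rewrite -[leLHS]/(2 * xi`_j * x + - xi`_j ^+ 2).
apply: piecewise_linear_ge; last by rewrite last_rcons.
- apply/(pathP (l, sq l)) => -[|k]; rewrite size_s => kn.
    rewrite /= nth_s// n1 -xi0.
    by have /andP[] := tau_itv 1%N n1.
  have kn' : (k < n)%N by [].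
  rewrite [nth _ (_ :: _) _]/= !nth_s// ?(ltnW kn')// kn'.
  have /andP[_ tk] := tau_itv k.+1 kn'.
  apply: (lt_le_trans tk); case: ltnP => [kn2|nk].
    by have /andP[/ltW] := tau_itv k.+2 kn2.
  by rewrite -xin /= (_ : k.+1 = n)//; apply/eqP; rewrite eqn_leq kn' nk.
- have above_sq (t : R) : 2 * xi`_j * t + - xi`_j ^+ 2 <= sq t.
    by rewrite -subr_ge0 (_ : _ - _ = (t - xi`_j) ^+ 2) ?sqr_ge0// /sq; ring.
  move=> q; rewrite inE => /predU1P[->|]; first exact: above_sq.
  rewrite mem_rcons inE => /predU1P[->|]; first exact: above_sq.
  move=> /mapP[i]; rewrite mem_iota add1n ltnS => i1n ->.
  rewrite tpE//= -subr_ge0.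
  rewrite [leRHS](_ : _ = (xi`_i.-1 - xi`_j) * (xi`_i - xi`_j)); last by field.
  have /andP[i0 iln] := i1n.
  have [ij|ji] := leqP i j.
    by rewrite mulr_le0// subr_le0 xi_le// ?ij ?jn// (leq_trans (leq_pred i)).
  rewrite mulr_ge0// subr_ge0 xi_le//; first by rewrite -ltnS prednK// ji /=
    (leq_trans (leq_pred i)).
  by rewrite (ltnW ji).
Qed.

(** * The two relaxations *)

Lemma secant_slopeE {R : realType} (l u : R) : l < u ->
  secant_slope l u = l + u.
Proof.
by move=> lu; rewrite /secant_slope /sq; field; rewrite subr_eq0 gt_eqF.
Qed.

Lemma vol3_naive_relaxation {R : realType} (l u : R) : 0 <= l -> l < u ->
  vol3 (naive_relaxation l u) =
    ((u - l) / 12 * ((u - l) ^+ 2 + l * u))%:E.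
Proof.
move=> l0 lu.
have -> : naive_relaxation l u = wedge l u 1 0 0 (l + u) (- (l * u)).
  rewrite /naive_relaxation secant_slopeE// /sq.
  have E x z : (l ^+ 2 - (l + u) * l) * z + (l + u) * x
      = (l + u) * x + - (l * u) * z by ring.
  have F x z : 1 * x ^+ 2 + 0 * x + 0 * z = x ^+ 2 :> R by ring.
  by apply/seteqP; split=> -[[x y] z]; rewrite /wedge /= E F.
rewrite vol3_wedge ?(ltW lu)//; first by congr EFin; field.
move=> x z /andP[z0 z1] /andP[lx xu]; rewrite -subr_ge0.
move: z0; rewrite le_eqVlt => /predU1P[z0|z0].
  by move: lx xu; rewrite -z0 !mulr0 => lx xu; rewrite (_ : x = 0); lra.
(* z times the height of a section is z times the gap between the secant and
   the perspective x^2 / z, plus x^2 (1 - z) *)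
rewrite -(pmulr_rge0 _ z0).
rewrite [leRHS](_ : _ = (x - l * z) * (u * z - x) + x ^+ 2 * (1 - z));
  last by ring.
by rewrite addr_ge0// mulr_ge0 ?sqr_ge0// subr_ge0.
Qed.

Section PerspectiveRelaxation.
Variables (R : realType) (l u : R) (n : nat) (xi : n.+1.-tuple R).
Hypotheses (lu : l < u) (n_ge1 : (1 <= n)%N).
Hypotheses (xi_first : xi`_0 = l) (xi_last : xi`_n = u).
Hypothesis xi_incr : sorted <%R xi.

Let P := perspective_relaxation l u xi.

Lemma perspective_tangent (j : nat) (x y z : R) : (j <= n)%N -> P (x, y, z) ->
  2 * xi`_j * x - xi`_j ^+ 2 * z <= y.
Proof.
move=> jn /hull_halfspace H; rewrite -subr_ge0.
rewrite [leRHS](_ : _ = - (2 * xi`_j) * x + 1 * y + xi`_j ^+ 2 * z + 0);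
  last by ring.
apply: H => {}x {}y {}z [/andP[gy _] /andP[lx xu] /andP[z0 _] _].
have := @tangent_under_estimator_ge _ l u _ j xi (x / z)
  n_ge1 xi_first xi_last xi_incr jn.
rewrite ler_pdivlMr// ler_pdivrMr// lx xu => /(_ isT).
rewrite -(ler_pM2l z0) => /le_trans/(_ gy).
rewrite [leLHS](_ : _ = 2 * xi`_j * x - xi`_j ^+ 2 * z); last first.
  by field; rewrite gt_eqF.
by move=> ?; lra.
Qed.

Lemma perspective_secant (x y z : R) : P (x, y, z) ->
  y <= (l + u) * x + - (l * u) * z.
Proof.
move=> /hull_halfspace H; rewrite -subr_ge0.
rewrite [leRHS](_ : _ = (l + u) * x + (- 1) * y + - (l * u) * z + 0);
  last by ring.
apply: H => {}x {}y {}z [/andP[_]]; rewrite secant_slopeE// /sq.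
by move=> ? _ _ _; lra.
Qed.

Lemma perspective_height (x y z : R) : P (x, y, z) -> 0 <= z <= 1.
Proof.
move=> Pp; apply/andP; split.
  rewrite [leRHS](_ : _ = 0 * x + 0 * y + 1 * z + 0); last by ring.
  by move: Pp; apply: hull_halfspace => {}x {}y {}z [_ _ /andP[? ?] _]; lra.
rewrite -subr_ge0 [leRHS](_ : _ = 0 * x + 0 * y + (- 1) * z + 1); last by ring.
by move: Pp; apply: hull_halfspace => {}x {}y {}z [_ _ /andP[? ?] _]; lra.
Qed.

Let above_tangent t a b := wedge a b 0 (2 * t) (- t ^+ 2) (l + u) (- (l * u)).

(** The bounds [l z <= x <= u z] come from the other constraints: a point above
    the tangent at [l] (resp. [u]) and below the secant satisfies
    [(u - l) (x - l z) >= 0] (resp. [(u - l) (u z - x) >= 0]). The wedges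
    meet where two consecutive tangents cross. *)
Lemma perspective_cover (c := xi`_1) :
  P `<=` above_tangent l l ((l + c) / 2)
    `|` above_tangent c ((l + c) / 2) ((c + u) / 2)
    `|` above_tangent u ((c + u) / 2) u.
Proof.
move=> [[x y] z] Pp.
have zz := perspective_height _ _ _ Pp; have yU := perspective_secant _ _ _ Pp.
have := perspective_tangent _ _ _ _ (leq0n n) Pp; rewrite xi_first => yl.
have := perspective_tangent _ _ _ _ n_ge1 Pp; rewrite -/c => yc.
have := perspective_tangent _ _ _ _ (leqnn n) Pp; rewrite xi_last => yu.
have ul0 : 0 < u - l by rewrite subr_gt0.
have lx : l * z <= x.
  rewrite -subr_ge0 -(pmulr_rge0 _ ul0); lra.
have xu : x <= u * z.
  rewrite -subr_ge0 -(pmulr_rge0 _ ul0); lra.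
have [x1|x1] := leP x ((l + c) / 2 * z).
  left; left; split=> //; last by rewrite lx.
  by apply/andP; split; [lra|].
have [x2|x2] := leP x ((c + u) / 2 * z).
  left; right; split=> //; last by rewrite (ltW x1).
  by apply/andP; split; [lra|].
right; split=> //; last by rewrite (ltW x2).
by apply/andP; split; [lra|].
Qed.

Lemma vol3_perspective_le (c := xi`_1) : l < c -> c <= u ->
  (vol3 P <= ((u - l) / 12 * ((u - l) ^+ 2 - (c - l) * (u - c)))%:E)%E.
Proof.
move=> lc cu.
have mP : measurable P by apply: closed_measurable3; exact: closed_closure.
have mu t a b : measurable (above_tangent t a b) by exact: measurable_wedge.
apply: (le_trans (vol3_le _ _ mP _ perspective_cover)).
  by do 2?[apply: measurableU].
rewrite -/c.
apply: (le_trans (vol3_setU _ _ _ _)) => //; first exact: measurableU.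
apply: (le_trans (leeD2r _ (vol3_setU _ _ _ _))) => //.
rewrite /above_tangent !vol3_wedge; [..|lra| |lra| |lra|].
- by rewrite -!EFinD lee_fin le_eqVlt; apply/orP; left; apply/eqP; field.
- move=> x z _ /andP[h1 h2]; rewrite -subr_ge0.
  rewrite [leRHS](_ : _ = (u - l) * (u * z - x)); last by ring.
  by rewrite mulr_ge0// subr_ge0// ltW.
- move=> x z _ /andP[h1 h2]; rewrite -subr_ge0.
  rewrite [leRHS](_ : _ = (u - c) * (x - (l + c) / 2 * z)
    + (c - l) * ((c + u) / 2 * z - x)); last by field.
  by rewrite addr_ge0// mulr_ge0// subr_ge0// ltW.
- move=> x z _ /andP[h1 h2]; rewrite -subr_ge0.
  rewrite [leRHS](_ : _ = (u - l) * (x - l * z)); last by ring.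
  by rewrite mulr_ge0// subr_ge0// ltW.
Qed.

End PerspectiveRelaxation.

Theorem corollary3p3 (R : realType) (l u : R) (n : nat) (xi : n.+1.-tuple R)
    (l_ge0 : 0 <= l) (lu : l < u) (n_ge1 : (1 <= n)%N)
    (xi_first : xi`_0 = l) (xi_last : xi`_n = u) (xi_incr : sorted <%R xi) :
  (vol3 (perspective_relaxation l u xi) <= vol3 (naive_relaxation l u))%E /\
  (vol3 (perspective_relaxation l u xi) = vol3 (naive_relaxation l u) ->
   n = 1%N /\ l = 0).
Proof.
have xi_lt := sorted_tuple_nth_lt _ _ xi_incr.
set c := xi`_1.
have lc : l < c by rewrite -xi_first xi_lt.
have cu : (n = 1%N /\ c = u) \/ c < u.
  have [n1|n1] := eqVneq n 1%N; first left.
    by split=> //; rewrite /c -xi_last; congr (nth 0 (tval xi) _).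
  by right; rewrite -xi_last xi_lt// leqnn andbT ltn_neqAle eq_sym n1.
have c_le_u : c <= u by case: cu => [[_ ->]|/ltW].
have volP := vol3_perspective_le _ _ _ _ _ lu n_ge1 xi_first xi_last xi_incr
  lc c_le_u.
rewrite vol3_naive_relaxation//.
have d0 : 0 < (u - l) / 12 by rewrite divr_gt0 ?subr_gt0.
have u0 : 0 < u by exact: le_lt_trans lu.
have lu0 : 0 <= l * u by rewrite mulr_ge0// ltW.
have cc0 : 0 <= (c - l) * (u - c) by rewrite mulr_ge0// subr_ge0// ltW.
split=> [|volPE].
  by apply: (le_trans volP); rewrite lee_fin ler_pM2l// -/c; lra.
move: volP; rewrite volPE lee_fin ler_pM2l// -/c => le0.
split.
  case: cu => [[]//|cu].
  have : 0 < (c - l) * (u - c) by rewrite mulr_gt0// subr_gt0.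
  by move=> ?; exfalso; lra.
have /eqP : l * u = 0 by lra.
by rewrite mulf_eq0 (gt_eqF u0) orbF => /eqP.
Qed.
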